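(* Let $\delta>0$ and let $N=(V,E,l)$ be an undirected connected network with edge length function $l:E\to\mathbb{R}_+$. Then the maximum number of variables and constraints of the reduced MILP model associated with $N$ and $\delta$ (defined in the context) only depends on $V$ and $E$; that is, these numbers are bounded by quantities determined by $V$ and $E$ alone, independently of the edge lengths.
   Context: Network and distances. $C(N)$ denotes the continuum of points on all edges and nodes of $N$; $l_e$ is the length of edge $e$; $d(p,p')$ is the length of a shortest path in $C(N)$ joining $p$ and $p'$. $V$ is totally ordered and every edge is written $e=(v_a,v_b)$ with $v_a\preceq v_b$; $e$ is also regarded as the set of its points (end nodes included). $E(v)$ is the set of edges incident to $v$. The Continuous Set-Covering Problem asks for a minimum cardinality finite set $\mathcal P\subset C(N)$ such that every point of $C(N)$ is at distance at most $\delta$ from some point of $\mathcal P$. Preprocessing. Each edge $e$ of the given network with $\delta<l_e\le 2\delta$ is subdivided into two sub-edges of length at most $\delta$. The model below is written for the resulting network, whose node and edge sets are again denoted $V$ and $E$ in the description of the model; so every edge satisfies $l_e\le\delta$ or $l_e>2\delta$. Let $L=\{e\in E: l_e>2\delta\}$ be the set of long edges, and for $e\in L$ let $\hat l_e:=l_e-2\delta\lfloor l_e/(2\delta)\rfloor$. Sets. $\mathcal F:=E\cup V$. For $e\in E$: $\mathcal E_c(e)=\{e'\in E:\forall p'\in e',\forall p\in e,\ d(p,p')\le\delta\}$, $\mathcal V_c(e)=\{v'\in V:\forall p\in e,\ d(p,v')\le\delta\}$, $\mathcal F_c(e)=\mathcal E_c(e)\cup\mathcal V_c(e)$. For $v\in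 V$: $\mathcal E(v)=\{e'=(v'_a,v'_b)\in E: d(v,v'_i)\le\delta\text{ for some }i\in\{a,b\}\}$, $\mathcal V(v)=\{v'\in V:d(v,v')\le\delta\}$, $\mathcal E_p(v)=\{e'\in\mathcal E(v):\exists e\in E(v),\ e'\notin\mathcal E_c(e)\}$, $\mathcal V_p(v)=\{v'\in\mathcal V(v):\exists e\in E(v),\ v'\notin\mathcal V_c(e)\}$, $\mathcal{EI}_p(v)=\{(e'=(v'_a,v'_b),i')\in\mathcal E_p(v)\times\{a,b\}: d(v,v'_{i'})\le\delta\}$. Variables. Binary: $y_f$ ($f\in\mathcal F$), $w_e$ ($e\in E$), $x_v$ ($v\in V$), $z_{vv'}$ ($v\in V$, $v'\in\mathcal V_p(v)$), $z_{ve'i'}$ ($v\in V$, $(e',i')\in\mathcal{EI}_p(v)$), $u_e$ ($e\in L$). Continuous nonnegative: $q_e$ ($e\in E$), $r_v$ ($v\in V$). For $(e',i')\in\mathcal{EI}_p(v)$ let $\tau_{ve'i'}$ be: if $e'\notin L$, $d(v,v'_a)+q_{e'}$ for $i'=a$ and $d(v,v'_b)+l_{e'}-q_{e'}$ for $i'=b$; if $e'\in L$, $d(v,v'_a)+q_{e'}$ for $i'=a$ and $d(v,v'_b)+2\delta u_{e'}+\hat l_{e'}-q_{e'}$ for $i'=b$. $M_v,M_{vv'},M_{ve'i'}$ are sufficiently large constants. Reduced MILP model: minimize $\sum_{f\in\mathcal F\setminus L}y_f+\sum_{e\in L}\big(\lceil l_e/(2\delta)\rceil-u_e\big)$ subject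 to - $w_e\ge y_f$ for $e\in E\setminus L$, $f\in\mathcal F_c(e)$; - $w_e\le\sum_{f\in\mathcal F_c(e)}y_f$ for $e\in E\setminus L$; - $l_e(1-w_e)\le r_{v_a}+r_{v_b}$ for $e=(v_a,v_b)\in E\setminus L$; - $y_{v'_{i'}}+y_{e'}\le1$ for $e'=(v'_a,v'_b)\in E\setminus L$, $i'\in\{a,b\}$; - $q_{e'}\le l_{e'}y_{e'}$ for $e'\in E\setminus L$; - $z_{ve'i'}\le y_{e'}$ for $v\in V$, $(e',i')\in\mathcal{EI}_p(v)$ with $e'\notin L$; - $x_v\ge1-\sum_{e\in E(v)}(1-w_e)$ for $v\in V$; $x_v\le w_e$ for $v\in V$, $e\in E(v)$; - $x_v+\sum_{v'\in\mathcal V_p(v)}z_{vv'}+\sum_{(e',i')\in\mathcal{EI}_p(v)}z_{ve'i'}=1$ for $v\in V$; - $z_{vv'}\le y_{v'}$ for $v\in V$, $v'\in\mathcal V_p(v)$; - $r_v\le M_v(1-x_v)$ for $v\in V$; - $r_v\le M_{vv'}(1-z_{vv'})+\delta-d(v,v')$ for $v\in V$, $v'\in\mathcal V_p(v)$; - $r_v\le M_{ve'i'}(1-z_{ve'i'})+\delta-\tau_{ve'i'}$ for $v\in V$, $(e',i')\in\mathcal{EI}_p(v)$; - $q_e\le\hat l_e(1-u_e)+2\delta u_e$ and $q_e\ge\hat l_eu_e$ for $e\in L$; - $r_{v_a}+\delta\ge q_e$ and $r_{v_b}+q_e-(2u_e-1)\delta\ge\hat l_e$ for $e=(v_a,v_b)\in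 L$; - $y_e=1$ and $w_e=0$ for $e\in L$; - the binary and nonnegativity restrictions on the variables. *)

(* Defs.v *)
From HB Require Import structures.
From mathcomp Require Import all_boot all_order all_algebra.
From mathcomp Require Import boolp classical_sets reals.

Set Implicit Arguments.
Unset Strict Implicit.
Unset Printing Implicit Defensive.

Import Order.TTheory GRing.Theory Num.Theory.
Local Open Scope ring_scope.

(* ---------- Mixed-integer linear programs ---------- *)

(* An affine expression  \sum_x c x * x + c0  is the pair (c, c0); the sum,
   opposite and scaling of expressions are those of this (product) module. *)
Definition aff (R : realType) (X : finType) : Type :=
  ({ffun X -> R^o} * R^o)%type.

Definition var (R : realType) (X : finType) (x : X) : aff R X :=
  ([ffun y => (y == x)%:R], 0).

Definition cst (R : realType) (X : finType) (c : R) : aff R X := (0, c).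

Definition aff_val (R : realType) (X : finType) (g : X -> R) (a : aff R X) : R :=
  \sum_(x : X) a.1 x * g x + a.2.

Inductive constr (R : realType) (X : finType) :=
  | CLe of aff R X & aff R X
  | CEq of aff R X & aff R X
  | Binary of X
  | NonNeg of X.

Definition satisfies (R : realType) (X : finType) (g : X -> R)
    (c : constr R X) : Prop :=
  match c with
  | CLe a b => aff_val g a <= aff_val g b
  | CEq a b => aff_val g a = aff_val g b
  | Binary x => g x = 0 \/ g x = 1
  | NonNeg x => 0 <= g x
  end.

(* The objective is to be minimized. *)
Record milp (R : realType) := Milp {
  milp_var : finType;
  milp_obj : aff R milp_var;
  milp_constrs : seq (constr R milp_var) }.

Definition num_variables (R : realType) (P : milp R) : nat := #|milp_var P|.
Definition num_constraints (R : realType) (P : milp R) : nat :=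
  size (milp_constrs P).

Definition feasible (R : realType) (P : milp R) (g : milp_var P -> R) : Prop :=
  forall i : 'I_(size (milp_constrs P)),
    satisfies g (tnth (in_tuple (milp_constrs P)) i).

Definition optimal (R : realType) (P : milp R) (g : milp_var P -> R) : Prop :=
  feasible g /\ forall h : milp_var P -> R, feasible h ->
    aff_val g (milp_obj P) <= aff_val h (milp_obj P).

(* ---------- Graphs ---------- *)

Definition total_order (T : Type) (le : rel T) : Prop :=
  [/\ reflexive le, antisymmetric le, transitive le & total le].

(* A finite undirected graph with totally ordered nodes, each edge being
   written (v_a, v_b) with v_a before v_b; loops and parallel edges are
   allowed. *)
Record graph := Graph {
  node : finType;
  edge : finType;
  node_le : rel node;
  node_leP : total_order node_le;
  va : edge -> node;
  vb : edge -> node;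
  va_le_vb : forall e, node_le (va e) (vb e) }.

Definition adjacent (G : graph) : rel (node G) := fun x y =>
  [exists e : edge G, ((va e == x) && (vb e == y)) || ((va e == y) && (vb e == x))].

Definition connected (G : graph) : Prop :=
  forall x y : node G, connect (@adjacent G) x y.

(* The end index i in {a, b} is a boolean: false is a, true is b. *)
Definition endp (G : graph) (e : edge G) (i : bool) : node G :=
  if i then vb e else va e.

Definition incident (G : graph) (v : node G) : {set edge G} :=
  [set e | (va e == v) || (vb e == v)]%SET.

(* ---------- The continuum of points of a network ---------- *)

(* Edge e is a segment parametrized by the distance t in [0, len e] to va e
   along e.  [EdgePt e t] stands for a point only if t lies strictly between 0
   and len e (see [at_offset]), so that the end nodes of edges are only
   represented by [NodePt]. *)
Inductive cpoint (R : realType) (G : graph) :=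
  | NodePt of node G
  | EdgePt of edge G & R.

Section Metric.
Context {R : realType} (G : graph) (len : edge G -> R).

Definition at_offset (p : cpoint R G) (e : edge G) (t : R) : Prop :=
  match p with
  | NodePt v => (v = va e /\ t = 0) \/ (v = vb e /\ t = len e)
  | EdgePt e' t' => [/\ e' = e, t' = t & 0 < t < len e]
  end.

Definition on_edge (p : cpoint R G) (e : edge G) : Prop :=
  exists t, at_offset p e t.

(* [cpath p q c]: some path from p to q, made of finitely many moves each
   within a single edge, has length c. *)
Inductive cpath : cpoint R G -> cpoint R G -> R -> Prop :=
  | cpath_nil p : cpath p p 0
  | cpath_cons p q r e s t c :
      at_offset p e s -> at_offset q e t -> cpath q r c ->
      cpath p r (`|s - t| + c).

(* The length of a shortest path, as an infimum. *)
Definition dist (p q : cpoint R G) : R := inf [set c | cpath p q c]%classic.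

End Metric.

(* ---------- Preprocessing ---------- *)

Section Preprocessing.
Context {R : realType} (G : graph) (len : edge G -> R) (delta : R).

Definition splits (e : edge G) : bool := delta < len e <= 2 * delta.

(* [cut e] is the offset, from va e, of the point at which e is subdivided. *)
Definition valid_cut (cut : edge G -> R) : Prop :=
  forall e, splits e -> cut e <= delta /\ len e - cut e <= delta.

Definition pre_node : finType := (node G + {e : edge G | splits e})%type.

Definition pre_edge : finType :=
  ({e : edge G | ~~ splits e} + {e : edge G | splits e} * bool)%type.

Definition pre_ends (f : pre_edge) : pre_node * pre_node :=
  match f with
  | inl e => (inl (va (val e)), inl (vb (val e)))
  | inr (e, false) => (inl (va (val e)), inr e)
  | inr (e, true) => (inr e, inl (vb (val e)))
  end.

Definition pre_len (cut : edge G -> R) (f : pre_edge) : R :=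
  match f with
  | inl e => len (val e)
  | inr (e, false) => cut (val e)
  | inr (e, true) => len (val e) - cut (val e)
  end.

Variables (le : rel pre_node) (leP : total_order le).

Definition pre_va (f : pre_edge) : pre_node :=
  if le (pre_ends f).1 (pre_ends f).2 then (pre_ends f).1 else (pre_ends f).2.

Definition pre_vb (f : pre_edge) : pre_node :=
  if le (pre_ends f).1 (pre_ends f).2 then (pre_ends f).2 else (pre_ends f).1.

Lemma pre_va_le_vb f : le (pre_va f) (pre_vb f).
Proof.
rewrite /pre_va /pre_vb; have [_ _ _ tot] := leP.
by have := tot (pre_ends f).1 (pre_ends f).2; case: ifP.
Qed.

Definition preprocess : graph := Graph leP pre_va_le_vb.

End Preprocessing.

(* ---------- Index sets of the model ---------- *)

Section Sets.
Context {R : realType} (G : graph) (len : edge G -> R) (delta : R).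

Definition dnode (v v' : node G) : R := dist len (NodePt R v) (NodePt R v').

Definition long (e : edge G) : bool := 2 * delta < len e.

Definition longs : {set edge G} := [set e | long e]%SET.

Definition hatl (e : edge G) : R :=
  len e - 2 * delta * (Num.floor (len e / (2 * delta)))%:~R.

Definition Ec (e : edge G) : {set edge G} :=
  [set e' | `[< forall p' p, on_edge len p' e' -> on_edge len p e ->
                  dist len p p' <= delta >]]%SET.

Definition Vc (e : edge G) : {set node G} :=
  [set v' | `[< forall p, on_edge len p e -> dist len p (NodePt R v') <= delta >]]%SET.

Definition facility : finType := (edge G + node G)%type.

Definition Fc (e : edge G) : {set facility} :=
  [set f : facility |
    match f with inl e' => e' \in Ec e | inr v' => v' \in Vc e end]%SET.

Definition Eball (v : node G) : {set edge G} :=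
  [set e' | [exists i, dnode v (endp e' i) <= delta]]%SET.

Definition Vball (v : node G) : {set node G} :=
  [set v' | dnode v v' <= delta]%SET.

Definition Ep (v : node G) : {set edge G} :=
  [set e' in Eball v | [exists e in incident v, e' \notin Ec e]]%SET.

Definition Vp (v : node G) : {set node G} :=
  [set v' in Vball v | [exists e in incident v, v' \notin Vc e]]%SET.

Definition EIp (v : node G) : {set edge G * bool} :=
  [set k | (k.1 \in Ep v) && (dnode v (endp k.1 k.2) <= delta)]%SET.

Definition zv_index : finType := {k : node G * node G | k.2 \in Vp k.1}.

Definition ze_index : finType :=
  {k : node G * (edge G * bool) | k.2 \in EIp k.1}.

Definition u_index : finType := {e : edge G | e \in longs}.

(* ---------- Variables ---------- *)

Inductive mvar :=
  | Y of facility
  | W of edge G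
  | X of node G
  | ZV of zv_index
  | ZE of ze_index
  | U of u_index
  | Q of edge G
  | RR of node G.

Definition mvar_sum : Type :=
  (facility + edge G + node G + zv_index + ze_index + u_index + edge G
   + node G)%type.

Definition mvar_to_sum (x : mvar) : mvar_sum :=
  match x with
  | Y f => inl (inl (inl (inl (inl (inl (inl f))))))
  | W e => inl (inl (inl (inl (inl (inl (inr e))))))
  | X v => inl (inl (inl (inl (inl (inr v)))))
  | ZV k => inl (inl (inl (inl (inr k))))
  | ZE k => inl (inl (inl (inr k)))
  | U e => inl (inl (inr e))
  | Q e => inl (inr e)
  | RR v => inr v
  end.

Definition mvar_of_sum (x : mvar_sum) : mvar :=
  match x with
  | inl (inl (inl (inl (inl (inl (inl f)))))) => Y f
  | inl (inl (inl (inl (inl (inl (inr e)))))) => W e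
  | inl (inl (inl (inl (inl (inr v))))) => X v
  | inl (inl (inl (inl (inr k)))) => ZV k
  | inl (inl (inl (inr k))) => ZE k
  | inl (inl (inr e)) => U e
  | inl (inr e) => Q e
  | inr v => RR v
  end.

Lemma mvar_to_sumK : cancel mvar_to_sum mvar_of_sum.
Proof. by case. Qed.

HB.instance Definition _ := Finite.copy mvar (can_type mvar_to_sumK).

End Sets.

(* The big-M constants M_v, M_{vv'} and M_{ve'i'}. *)
Record big_M (R : realType) (G : graph) := BigM {
  Mnode : node G -> R;
  Mnodenode : node G -> node G -> R;
  Mnodeedge : node G -> edge G -> bool -> R }.

(* ---------- The reduced model ---------- *)

Section Model.
Context {R : realType} (G : graph) (len : edge G -> R) (delta : R).
Variable M : big_M R G.

Local Notation V := (node G).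
Local Notation E := (edge G).
Local Notation mvar := (mvar len delta).
Local Notation L := (longs len delta).
Local Notation aff := (aff R mvar).
Local Notation "c %:K" := (cst mvar c) : ring_scope.

Definition y_ (f : facility G) : aff := var R (Y len delta f).
Definition w_ (e : E) : aff := var R (W len delta e).
Definition x_ (v : V) : aff := var R (X len delta v).
Definition zv_ (k : zv_index len delta) : aff := var R (ZV k).
Definition ze_ (k : ze_index len delta) : aff := var R (ZE k).
Definition u_ (e : u_index len delta) : aff := var R (U e).
Definition q_ (e : E) : aff := var R (Q len delta e).
Definition r_ (v : V) : aff := var R (RR len delta v).

Definition yE (e : E) : aff := y_ (inl e).
Definition yV (v : V) : aff := y_ (inr v).

Definition tau (k : ze_index len delta) : aff :=
  let: (v, (e', i')) := val k in
  if i' then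
    match (insub e' : option (u_index len delta)) with
    | None => (dnode len v (vb e'))%:K + (len e')%:K - q_ e'
    | Some eL => (dnode len v (vb e'))%:K + (2 * delta : R) *: u_ eL
                 + (hatl len delta e')%:K - q_ e'
    end
  else (dnode len v (va e'))%:K + q_ e'.

Definition objective : aff :=
  \sum_(f : facility G |
      match f with inl e => e \notin L | inr _ => true end) y_ f
  + \sum_(e : u_index len delta)
      (((Num.ceil (len (val e) / (2 * delta)))%:~R)%:K - u_ e).

(* The sums over v' in V_p(v) and over (e', i') in EI_p(v) are written as sums
   over the indices in [zv_index] and [ze_index] with first component v. *)
Definition constraints : seq (constr R mvar) :=
     [seq CLe (y_ f) (w_ e) | e <- enum (~: L), f <- enum (Fc len delta e)]
  ++ [seq CLe (w_ e) (\sum_(f in Fc len delta e) y_ f) | e <- enum (~: L)]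
  ++ [seq CLe (len e *: (1%:K - w_ e)) (r_ (va e) + r_ (vb e)) | e <- enum (~: L)]
  ++ [seq CLe (yV (endp e' i') + yE e') 1%:K
       | e' <- enum (~: L), i' <- [:: false; true]]
  ++ [seq CLe (q_ e') (len e' *: yE e') | e' <- enum (~: L)]
  ++ [seq CLe (ze_ k) (yE (val k).2.1)
       | k <- enum (ze_index len delta) & (val k).2.1 \notin L]
  ++ [seq CLe (1%:K - \sum_(e in incident v) (1%:K - w_ e)) (x_ v) | v <- enum V]
  ++ [seq CLe (x_ v) (w_ e) | v <- enum V, e <- enum (incident v)]
  ++ [seq CEq (x_ v
              + \sum_(k : zv_index len delta | (val k).1 == v) zv_ k
              + \sum_(k : ze_index len delta | (val k).1 == v) ze_ k) 1%:K
       | v <- enum V]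
  ++ [seq CLe (zv_ k) (yV (val k).2) | k <- enum (zv_index len delta)]
  ++ [seq CLe (r_ v) (Mnode M v *: (1%:K - x_ v)) | v <- enum V]
  ++ [seq CLe (r_ (val k).1)
             (Mnodenode M (val k).1 (val k).2 *: (1%:K - zv_ k)
              + delta%:K - (dnode len (val k).1 (val k).2)%:K)
       | k <- enum (zv_index len delta)]
  ++ [seq CLe (r_ (val k).1)
             (Mnodeedge M (val k).1 (val k).2.1 (val k).2.2 *: (1%:K - ze_ k)
              + delta%:K - tau k)
       | k <- enum (ze_index len delta)]
  ++ [seq CLe (q_ (val e)) (hatl len delta (val e) *: (1%:K - u_ e)
                          + (2 * delta : R) *: u_ e)
       | e <- enum (u_index len delta)]
  ++ [seq CLe (hatl len delta (val e) *: u_ e) (q_ (val e))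
       | e <- enum (u_index len delta)]
  ++ [seq CLe (q_ (val e)) (r_ (va (val e)) + delta%:K)
       | e <- enum (u_index len delta)]
  ++ [seq CLe (hatl len delta (val e))%:K
             (r_ (vb (val e)) + q_ (val e) - delta *: ((2 : R) *: u_ e - 1%:K))
       | e <- enum (u_index len delta)]
  ++ [seq CEq (yE e) 1%:K | e <- enum L]
  ++ [seq CEq (w_ e) 0%:K | e <- enum L]
  ++ [seq (match z with Q _ | RR _ => NonNeg R z | _ => Binary R z end)
       | z <- enum {: mvar}].

Definition reduced_milp : milp R := Milp objective constraints.

End Model.

(* Main.v *)
(** Preprocessing at most doubles the number of edges and adds at most one node
    per edge, and every index set of the model is a subset of a product of [V],
    [E] and the two edge ends.  So the model has polynomial size in [#|V| + #|E|]
    and [2 * #|E|], whatever the edge lengths. *)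

Require Import Defs.
From mathcomp Require Import all_boot all_order all_algebra reals.

Local Open Scope ring_scope.

(** Subdivision nodes and the indices of the [z] and [u] variables form subtypes cut out by
    conditions on lengths; forgetting the condition leaves a length-free bound. *)
Lemma card_sig_leq (T : finType) (P : pred T) : (#|{: {x : T | P x}}| <= #|T|)%N.
Proof. by rewrite card_sig; exact: max_card. Qed.

Lemma size_enum_leq (T : finType) (A : {pred T}) : (size (enum A) <= #|T|)%N.
Proof. by rewrite -cardE; exact: max_card. Qed.

(** The inner list may vary with the outer element, as [Fc e] and [incident v] do, so a uniform
    bound [n] on it is used. *)
Lemma size_allpairs_dep_leq (S T U : Type) (f : S -> T -> U) (s : seq S)
    (t : S -> seq T) (m n : nat) :
  (size s <= m)%N -> (forall x, (size (t x) <= n)%N) ->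
  (size [seq f x y | x <- s, y <- t x] <= m * n)%N.
Proof.
move=> sm tn; apply: leq_trans (leq_mul sm (leqnn n)).
elim: s {sm} => //= x s IHs.
by rewrite size_cat size_map mulSn leq_add.
Qed.

Lemma card_pre_node_leq (R : realType) (G : graph) (len : edge G -> R) (delta : R) :
  (#|pre_node len delta| <= #|node G| + #|edge G|)%N.
Proof. by rewrite card_sum leq_add2l; exact: card_sig_leq. Qed.

Lemma card_pre_edge_leq (R : realType) (G : graph) (len : edge G -> R) (delta : R) :
  (#|pre_edge len delta| <= 2 * #|edge G|)%N.
Proof.
(* Of the two halves of each split edge, one is grouped with the unsplit edges, which gives exactly
   [#|edge G|]; the other halves number at most [#|edge G|]. *)
rewrite card_sum card_prod card_bool !card_sig muln2 -addnn addnA mul2n -addnn.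
apply: leq_add; last exact: max_card.
by rewrite addnC cardC.
Qed.

Section ModelSize.
Context {R : realType} (G : graph) (len : edge G -> R) (delta : R).

Lemma card_zv_index_leq : (#|zv_index len delta| <= #|node G| * #|node G|)%N.
Proof. by rewrite -card_prod; exact: card_sig_leq. Qed.

Lemma card_ze_index_leq :
  (#|ze_index len delta| <= #|node G| * (#|edge G| * 2))%N.
Proof. by rewrite -card_bool -!card_prod; exact: card_sig_leq. Qed.

Lemma card_u_index_leq : (#|u_index len delta| <= #|edge G|)%N.
Proof. exact: card_sig_leq. Qed.

End ModelSize.

(** Here [n] counts nodes and [m] edges; the summands follow the constructors of [mvar], with
    [m + n] for [Y], and the factor 2 counts edge ends. *)
Definition variable_bound (n m : nat) : nat :=
  (m + n + m + n + n * n + n * (m * 2) + m + m + n)%N.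

(* The summands follow the order of the constraint families in [constraints]. *)
Definition constraint_bound (n m : nat) : nat :=
  (m * (m + n) + (m + (m + (m * 2 + (m + (n * (m * 2) + (n + (n * m
   + (n + (n * n + (n + (n * n + (n * (m * 2) + (m + (m + (m + (m
   + (m + (m + variable_bound n m)))))))))))))))))))%N.

(** Monotonicity replaces the size of the preprocessed graph, which depends on the lengths, by its
    bound in the original graph. *)
Lemma variable_bound_leq (n n' m m' : nat) : (n <= n')%N -> (m <= m')%N ->
  (variable_bound n m <= variable_bound n' m')%N.
Proof. by move=> nn mm; rewrite /variable_bound !(leq_add, leq_mul). Qed.

Lemma constraint_bound_leq (n n' m m' : nat) : (n <= n')%N -> (m <= m')%N ->
  (constraint_bound n m <= constraint_bound n' m')%N.
Proof.
move=> nn mm; rewrite /constraint_bound.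
by rewrite !(leq_add, leq_mul, variable_bound_leq).
Qed.

Lemma card_mvar_leq (R : realType) (G : graph) (len : edge G -> R) (delta : R) :
  (#|{: mvar len delta}| <= variable_bound #|node G| #|edge G|)%N.
Proof.
(* The variables inject into the sum type [mvar_sum], whose cardinality is computed summand by
   summand. *)
rewrite -(card_codom (can_inj (@mvar_to_sumK _ _ len delta))).
apply: leq_trans (max_card _) _.
rewrite !card_sum /variable_bound !leq_add //.
- exact: card_zv_index_leq.
- exact: card_ze_index_leq.
- exact: card_u_index_leq.
Qed.

Lemma num_constraints_leq (R : realType) (G : graph) (len : edge G -> R) (delta : R)
    (M : big_M R G) :
  (num_constraints (reduced_milp len delta M)
   <= constraint_bound #|node G| #|edge G|)%N.
Proof.
have le_zv := card_zv_index_leq G len delta.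
have le_ze := card_ze_index_leq G len delta.
have le_u := card_u_index_leq G len delta.
have size_enum_cond (T : finType) (p : pred T) (k : nat) :
    (#|T| <= k)%N -> (size [seq x <- enum T | p x] <= k)%N.
  by apply: leq_trans; rewrite cardE size_filter count_size.
rewrite /num_constraints /= /constraints !size_cat /constraint_bound.
(* The bound is nested to the right like the concatenation, so it splits family by family. The
   families left are the three doubly indexed ones, the filtered one and the variable
   restrictions. *)
rewrite !leq_add // ?size_map ?size_enum_leq // -?enumT -?cardE //.
- apply: size_allpairs_dep_leq => [|e]; first exact: size_enum_leq.
  by rewrite -card_sum size_enum_leq.
- by apply: size_allpairs_dep_leq => //; exact: size_enum_leq.
- exact: size_enum_cond.
- by apply: size_allpairs_dep_leq => [|v]; exact: size_enum_leq.
(* Each variable carries exactly one binary or nonnegativity restriction. *)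
- exact: card_mvar_leq.
Qed.

Theorem theorem6p1 (R : realType) :
  exists (max_variables max_constraints : graph -> nat),
  forall (G : graph) (l : edge G -> R) (delta : R),
    0 < delta ->
    (forall e : edge G, 0 <= l e) ->
    connected G ->
    forall (cut : edge G -> R)
           (le : rel (pre_node l delta)) (leP : total_order le)
           (M : big_M R (preprocess leP)),
      valid_cut l delta cut ->
      let P := reduced_milp (G := preprocess leP) (pre_len cut) delta M in
      (num_variables P <= max_variables G)%N /\
      (num_constraints P <= max_constraints G)%N.
Proof.
exists (fun G => variable_bound (#|node G| + #|edge G|) (2 * #|edge G|)).
exists (fun G => constraint_bound (#|node G| + #|edge G|) (2 * #|edge G|)).
move=> G l delta _ _ _ cut le leP M _ P.
have le_node := @card_pre_node_leq R G l delta.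
have le_edge := @card_pre_edge_leq R G l delta.
split.
- exact: leq_trans (card_mvar_leq R (preprocess leP) (pre_len cut) delta) (variable_bound_leq _ _ _ _ le_node le_edge).
- exact: leq_trans (num_constraints_leq R (preprocess leP) (pre_len cut) delta M)
    (constraint_bound_leq _ _ _ _ le_node le_edge).
Qed.
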